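(* Let $(X,d)$ be a finite metric space with $n=|X|$ points and doubling dimension $\dim$, let $k$ be an integer with $1\le k\le n-2$, let $0<\varepsilon\le \frac16$, and let $v\in X$. Then there exists a $(k, 1+10\varepsilon, v)$-vertex-fault-tolerant single-sink spanner $H_v$ of $X$ with maximum degree $(\frac{1}{\varepsilon})^{O(\dim)}\cdot k$, hop-diameter $O(\log n)$ with respect to the sink $v$, and total edge weight at most $(1+\varepsilon)(k+1)\sum_{x\in X} d(x,v)$.
   Context: A finite metric space is viewed as the complete graph on $X$ with edge weights $d(x,y)$; for a subgraph $H$, $d_H$ denotes shortest-path distance in $H$, and $H\setminus S$ denotes $H$ with the vertices of $S$ and their incident edges removed. The doubling dimension $\dim$ of $(X,d)$ is the smallest $\rho$ such that every ball in $X$ can be covered by $2^\rho$ balls of half the radius. For a root (sink) $v\in X$, a subgraph $H$ on $X$ is a $(k,t,v)$-vertex-fault-tolerant single-sink spanner ($(k,t,v)$-VFTssS) if for every $S\subseteq X\setminus\{v\}$ with $|S|\le k$ and every $x\in X\setminus S$, $d_{H\setminus S}(v,x)\le t\cdot d(v,x)$. Hop-diameter $O(\log n)$ with respect to $v$ means that every $x\in X$ is joined to $v$ in $H_v$ by a path of length at most $(1+10\varepsilon)d(v,x)$ consisting of $O(\log n)$ edges. Implicit constants in $O(\cdot)$ are independent of $n$, $k$, $\varepsilon$ and the metric space. *)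

(* Defs.v *)
From HB Require Import structures.
From mathcomp Require Import all_boot all_order all_algebra.
From mathcomp Require Import reals exp.
Set Implicit Arguments. Unset Strict Implicit. Unset Printing Implicit Defensive.
Import Order.TTheory GRing.Theory Num.Theory.
Local Open Scope ring_scope.

Definition is_metric {R : realType} {T : finType} (d : T -> T -> R) : Prop :=
  [/\ forall x y, 0 <= d x y,
      forall x y, d x y = 0 <-> x = y,
      forall x y, d x y = d y x &
      forall x y z, d x z <= d x y + d y z].

Definition ball_ {R : realType} {T : finType} (d : T -> T -> R) (x : T) (r : R)
  : {set T} := [set y | d x y <= r].

Definition doubling_cover {R : realType} {T : finType} (d : T -> T -> R) (rho : R)
  : Prop :=
  forall (x : T) (r : R), 0 < r ->
    exists C : {set T}, (#|C|%:R <= powR 2 rho) /\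
      forall y, y \in ball_ d x r -> exists2 c, c \in C & y \in ball_ d c (r / 2).

Definition is_doubling_dim {R : realType} {T : finType} (d : T -> T -> R) (rho : R)
  : Prop :=
  doubling_cover d rho /\ forall rho', doubling_cover d rho' -> rho <= rho'.

Definition simple_graph {T : finType} (H : rel T) : Prop :=
  (forall x, ~~ H x x) /\ (forall x y, H x y = H y x).

Definition walk {T : finType} (H : rel T) (u w : T) (p : seq T) : Prop :=
  path H u p /\ last u p = w.

Fixpoint walk_len {R : realType} {T : finType} (d : T -> T -> R) (u : T) (p : seq T)
  : R :=
  match p with
  | [::] => 0
  | y :: q => d u y + walk_len d y q
  end.

Definition dist_avoid_le {R : realType} {T : finType} (d : T -> T -> R) (H : rel T)
  (S : {set T}) (u w : T) (b : R) : Prop :=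
  exists p : seq T, [/\ walk H u w p, all (fun z => z \notin S) (u :: p)
                      & walk_len d u p <= b].

Definition VFTssS {R : realType} {T : finType} (d : T -> T -> R) (H : rel T)
  (k : nat) (t : R) (v : T) : Prop :=
  forall S : {set T}, v \notin S -> (#|S| <= k)%N ->
    forall x, x \notin S -> dist_avoid_le d H S v x (t * d v x).

Definition deg {T : finType} (H : rel T) (x : T) : nat := #|[set y | H x y]|.

(* total edge weight: each unordered edge counted once *)
Definition total_weight {R : realType} {T : finType} (d : T -> T -> R) (H : rel T)
  : R := (\sum_(p : T * T | H p.1 p.2) d p.1 p.2) / 2.

(* Main.v *)
(* Every x <> v is given a set of parents, either {v} or k + 1 points, so that
   one parent survives any k faults; edges join points to their parents, and a
   potential that grows by at least d(x, y) from a parent y to x bounds the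
   length of every path that climbs from x to v.

   Points far from v: given portals P with d(p, v) <= eps d(x, v) for all x in
   F, let Q be the k + 1 points of F nearest to v and r their maximal distance.
   The points of Q get P as parents.  The remaining points at distance at most
   r / eps are cut into eps^(-O(dim)) clusters of diameter eps r, each attached
   to P.  The others are cut into two halves, each attached recursively to the
   portals Q; halving makes the depth logarithmic.

   Inside a cluster of diameter D, any k + 1 points serve as roots, and the rest
   is cut into 2^O(dim) clusters of diameter D / 2 and at most half the size,
   attached to the roots.  So detours sum to at most 2 D, the depth is
   logarithmic, and every edge weighs at most (1 + eps) d(x, v). *)

Require Import Defs.
From HB Require Import structures.
From mathcomp Require Import all_boot all_order all_algebra.
From mathcomp Require Import reals exp.
From mathcomp Require Import ring lra zify.
Set Implicit Arguments. Unset Strict Implicit. Unset Printing Implicit Defensive.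
Import Order.TTheory GRing.Theory Num.Theory.
Local Open Scope ring_scope.

(** * Finite sets: sizes of unions and nearest points *)

Lemma card_bigcup_le (T I : finType) (P : pred I) (A : I -> {set T}) :
  (#|\bigcup_(i | P i) A i| <= \sum_(i | P i) #|A i|)%N.
Proof.
elim/big_rec2: _ => [|i n X _ leXn]; first by rewrite cards0.
by apply: leq_trans (leq_card_setU _ _) _; rewrite leq_add2l.
Qed.

(** Greedy: each added point minimises [f] outside the set so far. A constant [f] serves to pick an
    arbitrary subset of prescribed size. *)
Lemma nearest_subset (R : realType) (T : finType) (f : T -> R) (F : {set T}) n :
  (n <= #|F|)%N -> exists Q : {set T}, [/\ Q \subset F, #|Q| = n &
    forall q x, q \in Q -> x \in F :\: Q -> f q <= f x].
Proof.
elim: n => [_|n IHn ltnF].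
  by exists set0; rewrite sub0set cards0; split=> // q x; rewrite in_set0.
have [Q [sQF cQ nearQ]] := IHn (ltnW ltnF).
have /card_gt0P[x0 Fx0] : (0 < #|F :\: Q|)%N.
  by rewrite cardsD (setIidPr sQF) cQ subn_gt0.
case: (arg_minP f Fx0) => z Fz minz; exists (z |: Q); split.
- by rewrite subUset sub1set sQF andbT; case/setDP: Fz.
- by rewrite cardsU1 cQ; case/setDP: Fz => _ ->.
move=> q x; rewrite !inE negb_or => /orP[/eqP->|Qq] /andP[/andP[_ nQx] Fx].
  by apply: minz; apply/setDP.
by apply: nearQ => //; apply/setDP.
Qed.

(** * Attaching points to portals, and gluing attachments *)

Section Attachment.

Variables (R : realType) (T : finType) (d : T -> T -> R) (v : T).
Variables (k : nat) (eps : R) (B h : nat).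

(** The upper bound limits degree and weight; the alternative leaves a parent outside any [k]
    faults, since [v] never fails. *)
Definition robust (Z : {set T}) : bool :=
  (#|Z| <= k.+1)%N && ((v \in Z) || (k < #|Z|)%N).

(* A choice of parents for the points of [F] among [F] and the portals [P].
   [pot] bounds the length and [lvl] the number of hops of the paths to [v];
   [pot0] and [lvl0] are their values on [P], where they are prescribed. *)
Record attachment (F P : {set T}) (pot0 : T -> R) (lvl0 p : nat)
    (par : T -> {set T}) (pot : T -> R) (lvl : T -> nat) : Prop := Attachment {
  att_par : forall x, x \in F -> par x \subset F :|: P;
  att_robust : forall x, x \in F -> robust (par x);
  att_light : forall x y, x \in F -> y \in par x -> d x y <= (1 + eps) * d x v;
  att_degF : forall y, y \in F -> (#|[set x in F | y \in par x]| <= B)%N;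
  att_degP : forall y, y \in P -> (#|[set x in F | y \in par x]| <= p)%N;
  att_pot : forall x y, x \in F -> y \in par x ->
    d x y + (if y \in F then pot y else pot0 y) <= pot x;
  att_lvl : forall x y, x \in F -> y \in par x ->
    ((if y \in F then lvl y else lvl0) < lvl x)%N;
  att_pot_le : forall x, x \in F -> pot x <= (1 + 10 * eps) * d x v;
  att_lvl_le : forall x, x \in F -> (lvl x <= h)%N }.

Definition attachable (F P : {set T}) (pot0 : T -> R) (lvl0 p : nat) : Prop :=
  exists par pot lvl, attachment F P pot0 lvl0 p par pot lvl.

Lemma attachable0 P pot0 lvl0 p : attachable set0 P pot0 lvl0 p.
Proof.
exists (fun=> set0), (fun=> 0), (fun=> 0%N).
split=> [x|x|x y|y|y _|x y|x y|x|x]; rewrite ?inE //.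
rewrite (_ : [set _ in _ | _] = set0) ?cards0 //.
by apply/setP=> x; rewrite !inE.
Qed.

(** One recursion step, shared by all constructions: [Q] hangs from [P], and class [i] of the rest
    hangs from [P] or from [Q] according to [toP i]. A point of [Q] gets children only from the
    classes hanging from [Q], a portal from [Q] and the classes hanging from [P], and any other
    point only from its own class, where the bound [B] already holds. *)
Lemma attachable_glue (I : finType) (F Q P : {set T}) (idx : T -> I)
    (toP : pred I) (pI : I -> nat) (pot0 potQ : T -> R) (lvl0 p : nat) :
    robust P -> [disjoint P & F] -> Q \subset F -> (lvl0 < h)%N ->
    (forall x y, x \in Q -> y \in P -> d x y <= (1 + eps) * d x v) ->
    (forall x y, x \in Q -> y \in P -> d x y + pot0 y <= potQ x) ->
    (forall x, x \in Q -> potQ x <= (1 + 10 * eps) * d x v) ->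
    (forall i, attachable [set x in F :\: Q | idx x == i]
       (if toP i then P else Q) (if toP i then pot0 else potQ)
       (if toP i then lvl0 else lvl0.+1) (pI i)) ->
    (\sum_(i | ~~ toP i) pI i <= B)%N ->
    (#|Q| + \sum_(i | toP i) pI i <= p)%N ->
  attachable F P pot0 lvl0 p.
Proof.
move=> robP disPF sQF lt_h lightQ potQP potQ_le attI leB lep.
have [par_ /fin_all_exists[pot_ /fin_all_exists[lvl_ att]]] := fin_all_exists attI.
have PnF y : y \in P -> (y \in F) = false by move/(disjointFr disPF).
have FnP y : y \in F -> (y \in P) = false by move/(disjointFl disPF).
have inF x : x \in F -> (x \in Q) = false ->
    x \in [set x' in F :\: Q | idx x' == idx x] by move=> Fx Qx; rewrite !inE Fx Qx eqxx.
have parP x y : x \in F -> (x \in Q) = false -> y \in par_ (idx x) x ->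
    [|| y \in [set x' in F :\: Q | idx x' == idx x],
        toP (idx x) && (y \in P) | ~~ toP (idx x) && (y \in Q)].
  move=> Fx Qx /(subsetP (att_par (att (idx x)) (inF _ Fx Qx))).
  by rewrite in_setU => /orP[->//|]; case: (toP _) => /= ->; rewrite ?orbT.
exists (fun x => if x \in Q then P else par_ (idx x) x).
exists (fun x => if x \in Q then potQ x else pot_ (idx x) x).
exists (fun x => if x \in Q then lvl0.+1 else lvl_ (idx x) x).
have childF x y : x \in F -> y \in F -> (x \in Q) = false -> (y \in Q) = false ->
    y \in par_ (idx x) x -> idx y = idx x.
  move=> Fx Fy Qx Qy /(parP _ y Fx Qx).
  by rewrite Qy (FnP y Fy) !andbF !orbF !inE => /andP[_ /eqP].
split=> [x Fx|x Fx|x y Fx|y Fy|y Py|x y Fx|x y Fx|x Fx|x Fx].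
- case Qx: (x \in Q); first exact: subsetUr.
  apply/subsetP=> y /(parP _ y Fx Qx); rewrite !inE.
  case/or3P=> [/andP[/andP[_ ->]] //|/andP[_ ->]|/andP[_ Qy]]; first by rewrite orbT.
  by rewrite (subsetP sQF).
- case Qx: (x \in Q) => //.  exact: (att_robust (att (idx x)) (inF _ Fx Qx)).
- case Qx: (x \in Q); first exact: lightQ.
  exact: (att_light (att (idx x)) (inF _ Fx Qx)).
- case Qy: (y \in Q).
    apply: leq_trans leB; pose A i := [set x in [set x in F :\: Q | idx x == i] | y \in par_ i x].
    apply: (@leq_trans #|\bigcup_(i | ~~ toP i) A i|); last first.
      apply: leq_trans (card_bigcup_le _ _) _; apply: leq_sum => i nPi.
      by have := att_degP (att i); rewrite (negPf nPi); apply.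
    apply/subset_leq_card/subsetP=> x; rewrite inE => /andP[Fx].
    case Qx: (x \in Q); first by rewrite FnP.
    move=> par_y; apply/bigcupP; exists (idx x); last by rewrite !inE Fx Qx eqxx.
    by have := parP _ y Fx Qx par_y; rewrite !inE Qy FnP // andbF andbT.
  apply: leq_trans (att_degF (att (idx y)) (inF _ Fy Qy)).
  apply/subset_leq_card/subsetP=> x; rewrite inE => /andP[Fx].
  case Qx: (x \in Q); first by rewrite FnP.
  by move=> par_y; rewrite !inE Fx Qx (childF x y Fx Fy Qx Qy par_y) eqxx.
- apply: leq_trans lep; pose A i := [set x in [set x in F :\: Q | idx x == i] | y \in par_ i x].
  apply: (@leq_trans #|Q :|: \bigcup_(i | toP i) A i|); last first.
    apply: leq_trans (leq_card_setU _ _) _; rewrite leq_add2l.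
    apply: leq_trans (card_bigcup_le _ _) _; apply: leq_sum => i Pi.
    by have := att_degP (att i); rewrite Pi; apply.
  apply/subset_leq_card/subsetP=> x; rewrite !inE => /andP[Fx].
  case Qx: (x \in Q) => //= par_y.
  apply/bigcupP; exists (idx x); last by rewrite !inE Fx Qx eqxx.
  have := parP _ y Fx Qx par_y; rewrite !inE PnF // !andbF /= => /orP[/andP[]//|].
  by case/andP=> _ /(subsetP sQF); rewrite PnF.
- case Qx: (x \in Q); first by move=> Py; rewrite PnF //; apply: potQP.
  move=> par_y.
  have := att_pot (att _) (inF _ Fx Qx) par_y.
  have := parP _ y Fx Qx par_y; rewrite !inE.
  case Fy: (y \in F); case Qy: (y \in Q) => /=.
  - by rewrite FnP // andbF andbT orFb => /negPf->.
  - by rewrite FnP // !andbF !orbF => /eqP->; rewrite eqxx.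
  - by rewrite (subsetP sQF) in Fy.
  - by rewrite !andbF !orbF => /andP[-> _].
- case Qx: (x \in Q); first by move=> Py; rewrite PnF.
  move=> par_y.
  have := att_lvl (att _) (inF _ Fx Qx) par_y.
  have := parP _ y Fx Qx par_y; rewrite !inE.
  case Fy: (y \in F); case Qy: (y \in Q) => /=.
  - by rewrite FnP // andbF andbT orFb => /negPf->.
  - by rewrite FnP // !andbF !orbF => /eqP->; rewrite eqxx.
  - by rewrite (subsetP sQF) in Fy.
  - by rewrite !andbF !orbF => /andP[-> _].
- case Qx: (x \in Q); first exact: potQ_le.
  exact: (att_pot_le (att (idx x)) (inF _ Fx Qx)).
- case Qx: (x \in Q) => //.
  exact: (att_lvl_le (att (idx x)) (inF _ Fx Qx)).
Qed.

(** * Recursive attachment of clusters and rings *)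

(** Halving the diameter makes detours a geometric series; halving the cardinality makes the depth
    logarithmic. *)
Definition halving_split (N : nat) : Prop :=
  forall (C : {set T}) (r : R), (1 < #|C|)%N ->
    {in C &, forall x y, d x y <= r} ->
    exists f : T -> 'I_N,
      {in C &, forall x y, f x = f y -> d x y <= r / 2} /\
      forall i, (2 * #|[set x in C | f x == i]| <= #|C|)%N.

Definition ring_split (M : nat) : Prop :=
  forall (A : {set T}) (r : R), 0 < r -> {in A, forall x, d x v <= r / eps} ->
    exists f : T -> 'I_M, {in A &, forall x y, f x = f y -> d x y <= eps * r}.

Lemma attachable_small (F P : {set T}) (pot0 potF : T -> R) (lvl0 p : nat) :
    robust P -> [disjoint P & F] -> (lvl0 < h)%N -> (#|F| <= p)%N ->
    (forall x y, x \in F -> y \in P -> d x y <= (1 + eps) * d x v) ->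
    (forall x y, x \in F -> y \in P -> d x y + pot0 y <= potF x) ->
    (forall x, x \in F -> potF x <= (1 + 10 * eps) * d x v) ->
  attachable F P pot0 lvl0 p.
Proof.
move=> robP disPF lt_h leFp lightF potFP potF_le.
apply: (@attachable_glue unit F F P (fun=> tt) predT (fun=> 0%N) pot0 potF) => //.
- by move=> i; rewrite setDv (_ : [set _ in _ | _] = set0);
    [exact: attachable0 | apply/setP=> x; rewrite !inE].
- by rewrite big1.
- by rewrite big1 // addn0.
Qed.

(** Here [b] bounds the potential of points attached directly to [P]. One level down, [b] and [D]
    become [b + D] and [D / 2], so [b + 2 * D] is invariant and the budget is never exceeded. All
    classes hang from the roots [Q], so a portal carries only [k.+1] children, whatever [N] is. *)
Lemma attachable_cluster (N m : nat) (F P : {set T}) (pot0 : T -> R) (lvl0 : nat)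
    (D b : R) :
    (forall x y, 0 <= d x y) -> (0 < k)%N ->
    halving_split N ->
    (N * k.+1 <= B)%N ->
    (#|F| < 2 ^ m)%N -> (lvl0 + m <= h)%N ->
    robust P -> [disjoint P & F] -> {in F &, forall x y, d x y <= D} ->
    (forall x y, x \in F -> y \in P -> d x y <= (1 + eps) * d x v) ->
    (forall x y, x \in F -> y \in P -> d x y + pot0 y <= b) ->
    (forall x, x \in F -> b + 2 * D <= (1 + 10 * eps) * d x v) ->
    (forall x, x \in F -> D <= (1 + eps) * d x v) ->
  attachable F P pot0 lvl0 k.+1.
Proof.
move=> d_ge0 k_gt0 split_half leB.
elim: m F P pot0 lvl0 D b => [|m IHm] F P pot0 lvl0 D b ltF lev robP disPF diamF lightF potP bF DF.
  by rewrite (_ : F = set0); [exact: attachable0 | apply/eqP; rewrite -cards_eq0; lia].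
have [Fsmall|kF] := leqP #|F| k.+1.
  apply: (attachable_small (potF := fun=> b)) => //; first by lia.
  move=> x Fx; have := bF x Fx; have := diamF x x Fx Fx; have := d_ge0 x x; lra.
have D_ge0 : 0 <= D.
  have /card_gt0P[x Fx] : (0 < #|F|)%N by lia.
  exact: le_trans (diamF x x Fx Fx).
have [Q [sQF cQ _]] := nearest_subset (fun=> 0 : R) (ltnW kF).
have F_gt1 : (1 < #|F|)%N by lia.
have [f [diamf halff]] := split_half F D F_gt1 diamF.
have robQ : robust Q by rewrite /robust cQ leqnn orbT.
apply: (@attachable_glue 'I_N F Q P f pred0 (fun=> k.+1) pot0 (fun=> b)) => //.
- lia.
- by move=> x y /(subsetP sQF); apply: lightF.
- by move=> x y /(subsetP sQF); apply: potP.
- move=> x /(subsetP sQF) Fx; have := bF x Fx; lra.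
- move=> i /=; set Fi := [set _ in _ | _].
  have FiF x : x \in Fi -> x \in F by rewrite !inE => /andP[/andP[]].
  have Fif x : x \in Fi -> f x = i by rewrite !inE => /andP[_ /eqP].
  (* The new portals are the roots: their potential is [b], and they lie within [D] of the class. *)
  apply: (IHm _ _ _ _ (D / 2) (b + D)) => //.
  + have : (#|Fi| <= #|[set x in F | f x == i]|)%N.
      apply/subset_leq_card/subsetP=> x Fix.
      by rewrite inE FiF // Fif // eqxx.
    have := halff i; move: ltF; rewrite expnS; lia.
  + lia.
  + apply/pred0P=> x /=; apply/negP=> /andP[Qx]; rewrite !inE Qx //.
  + by move=> x y Fx Fy; apply: diamf; rewrite ?FiF // !Fif.
  + move=> x y Fx Qy; apply: le_trans (DF x (FiF x Fx)).
    by apply: diamF; [apply: FiF | apply: (subsetP sQF)].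
  + move=> x y Fx Qy; rewrite addrC lerD2l.
    by apply: diamF; [apply: FiF | apply: (subsetP sQF)].
  + move=> x Fx; have := bF x (FiF x Fx); lra.
  + move=> x Fx; have := DF x (FiF x Fx); lra.
- rewrite sum_nat_const (eq_card (B := predT)) // card_ord. exact: leB.
- by rewrite big_pred0 // addn0 cQ.
Qed.

(** A portal carries [k.+1] children from each of the [M] clusters and [k.+1] from [Q]; points of
    [Q] become portals of two halves, hence the factor 2 in [B]. A round costs one level, and its
    clusters at most [m] levels at size bound [2 ^ m], so [2 * m] levels suffice. *)
Lemma attachable_rings (N M m : nat) (F P : {set T}) (lvl0 : nat) :
    is_metric d -> (0 < k)%N -> 0 < eps -> eps <= 6^-1 ->
    halving_split N ->
    ring_split M ->
    (N * k.+1 <= B)%N -> (2 * (M.+1 * k.+1) <= B)%N ->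
    (#|F| < 2 ^ m)%N -> (lvl0 + 2 * m <= h)%N ->
    robust P -> [disjoint P & F] -> v \notin F ->
    (forall x y, x \in F -> y \in P -> d y v <= eps * d x v) ->
  attachable F P (fun y => (1 + 10 * eps) * d y v) lvl0 (M.+1 * k.+1).
Proof.
move=> [d_ge0 d_eq0 dC d_tri] k_gt0 eps_gt0 eps_le split_half cover_ring leB leB2.
have le_eps : eps <= 1 / 6 by lra.
(* The larger half is rounded up, hence [a.+1]; removing the [k.+1] points of [Q] supplies the
   slack. *)
have halves a n : (a.+1 < 2 * n)%N -> (a./2 < n)%N /\ (a - a./2 < n)%N by lia.
elim: m F P lvl0 => [|m IHm] F P lvl0 ltF lev robP disPF vF nearP.
  by rewrite (_ : F = set0); [exact: attachable0 | apply/eqP; rewrite -cards_eq0; lia].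
have lt_h : (lvl0 < h)%N by lia.
have le_h1 : (lvl0 + m.+1 <= h)%N by lia.
have le_h2 : (lvl0.+1 + 2 * m <= h)%N by lia.
have leB' : (M.+1 * k.+1 + M.+1 * k.+1 <= B)%N by lia.
have epsd x : 0 <= eps * d x v by rewrite mulr_ge0 // ltW.
have epsd2 x : eps * (eps * d x v) <= 1 / 6 * (eps * d x v) by rewrite ler_wpM2r.
have lightP x y : x \in F -> y \in P -> d x y <= (1 + eps) * d x v.
  move=> Fx Py; have := d_tri x v y; rewrite (dC v y); have := nearP x y Fx Py; lra.
(* The detour costs at most [(2 + 10 * eps) * eps * d x v], and [2 + 10 / 6 < 4]. The remaining
   [6 * eps] is kept for the clusters. *)
have potP x y : x \in F -> y \in P ->
    d x y + (1 + 10 * eps) * d y v <= (1 + 4 * eps) * d x v.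
  move=> Fx Py; have := d_tri x v y; rewrite (dC v y); have le_y := nearP x y Fx Py.
  have : eps * d y v <= 1 / 6 * d y v by rewrite ler_wpM2r.
  have := epsd x; lra.
have potP' x y : x \in F -> y \in P ->
    d x y + (1 + 10 * eps) * d y v <= (1 + 10 * eps) * d x v.
  by move=> Fx Py; have := potP x y Fx Py; have := epsd x; lra.
have [Fsmall|kF] := leqP #|F| k.+1.
  apply: (attachable_small (potF := fun y => (1 + 10 * eps) * d y v)) => //.
  by apply: leq_trans Fsmall _; rewrite mulSn leq_addr.
have [Q [sQF cQ nearQ]] := nearest_subset (fun x => d x v) (ltnW kF).
have robQ : robust Q by rewrite /robust cQ leqnn orbT.
have /card_gt0P[q0 Qq0] : (0 < #|Q|)%N by rewrite cQ.
have [q Qq maxq] := arg_maxP (fun x => d x v) Qq0.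
set rho := d q v in maxq.
have rho_gt0 : 0 < rho.
  rewrite lt_neqAle d_ge0 andbT eq_sym; apply: contraNneq vF => /d_eq0 <-.
  exact: (subsetP sQF).
pose A := [set x in F :\: Q | d x v <= rho / eps].
have [|f clusterf] := cover_ring A rho rho_gt0.
  by move=> x; rewrite inE => /andP[].
pose F' := F :\: (Q :|: A).
have leF' : (#|F'|./2 <= #|F'|)%N by rewrite -divn2 leq_div.
have [L [sLF cL _]] := nearest_subset (fun=> 0 : R) leF'.
have cF' : (#|F'| + k.+1 <= #|F|)%N.
  rewrite -cQ -(cardsID Q F) (setIidPr sQF) addnC leq_add2l.
  by apply: subset_leq_card; apply: setDS; apply: subsetUl.
have ltF' : (#|F'|.+1 < 2 * 2 ^ m)%N.
  rewrite -expnS; apply: leq_ltn_trans ltF; apply: leq_trans cF'.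
  by rewrite -addn1 leq_add2l.
have [ltL ltU] := halves _ _ ltF'.
have F'far x y : x \in F' -> y \in Q -> d y v <= eps * d x v.
  rewrite !inE negb_or !negb_and -ltNge => /andP[/andP[nQx]].
  rewrite nQx /= => /orP[/negP//|far_x] Fx Qy.
  apply: le_trans (maxq y Qy) _; rewrite mulrC -ler_pdivrMr //.
  exact: ltW.
pose idx x : 'I_M + bool := if x \in A then inl (f x) else inr (x \in L).
pose toP (i : 'I_M + bool) := if i is inl _ then true else false.
pose pI (i : 'I_M + bool) := if i is inl _ then k.+1 else (M.+1 * k.+1)%N.
apply: (@attachable_glue _ F Q P idx toP pI _ (fun y => (1 + 10 * eps) * d y v)) => //.
- by move=> x y /(subsetP sQF); apply: lightP.
- by move=> x y /(subsetP sQF); apply: potP'.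
- case=> [i|s] /=.
  + set Fi := [set _ in _ | _].
    have FiA x : x \in Fi -> x \in A /\ f x = i.
      rewrite 2!inE => /andP[_]; rewrite /idx.
      by case: (x \in A) => // /eqP[->].
    have FiF x : x \in Fi -> x \in F by case/FiA; rewrite inE => /andP[/setDP[]].
    have [->|[z Fz]] := set_0Vmem Fi; first exact: attachable0.
    have rho_le x : x \in Fi -> eps * rho <= eps * d x v.
      case/FiA; rewrite inE => /andP[FQx _] _.
      by rewrite ler_wpM2l ?(ltW eps_gt0) // nearQ.
    have diamFi : {in Fi &, forall x y, d x y <= eps * rho}.
      by move=> x y /FiA[Ax fx] /FiA[Ay fy]; apply: clusterf; rewrite // fx fy.
    have er_ge0 : 0 <= eps * rho by rewrite mulr_ge0 ?ltW.
    have er2 : eps * (eps * rho) <= 1 / 6 * (eps * rho) by rewrite ler_wpM2r.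
    have near x y : x \in Fi -> y \in Fi ->
        (1 + 4 * eps) * d x v <= (1 + 4 * eps) * (d y v + eps * rho).
      move=> Fx Fy; rewrite ler_wpM2l //; first lra.
      by have := d_tri x y v; have := diamFi x y Fx Fy; lra.
    (* Passing from [z] back to [x] gives [b <= (1 + 4 * eps) * (d x v + 2 * eps * rho)]. So
       [b + 2 * D] exceeds [(1 + 4 * eps) * d x v] by at most [(4 + 8 * eps) * eps * rho], which is
       below [6 * eps * d x v] because [rho <= d x v] outside [Q]. *)
    apply: (attachable_cluster (N := N) (m := m.+1) (D := eps * rho)
              (b := (1 + 4 * eps) * (d z v + eps * rho))) => //.
    * apply: leq_ltn_trans ltF; apply/subset_leq_card/subsetP; exact: FiF.
    * by apply: disjointWr disPF; apply/subsetP; exact: FiF.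
    * by move=> x y /FiF; apply: lightP.
    * move=> x y Fx Py; apply: le_trans (potP x y (FiF x Fx) Py) _; exact: near.
    * move=> x Fx; have := near z x Fz Fx; have := epsd x; have := epsd2 x.
      have := rho_le x Fx; lra.
    * by move=> x Fx; have := rho_le x Fx; have := d_ge0 x v; lra.
  + set Fi := [set _ in _ | _].
    have FiF' x : x \in Fi -> x \in F' /\ (x \in L) = s.
      rewrite !inE /idx; case Ax: (x \in A); rewrite ?andbF //.
      rewrite inE in Ax; move: Ax; rewrite inE.
      by case: (x \in Q) => //=; case: (x \in F) => //= -> /eqP[->].
    have FiF x : x \in Fi -> x \in F by case/FiF' => /setDP[].
    apply: IHm => //.
    * have sub : Fi \subset if s then L else F' :\: L.
        apply/subsetP=> x /FiF'[F'x]; case: s {Fi FiF' FiF} => // /negbT nLx.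
        by rewrite inE nLx.
      apply: leq_ltn_trans (subset_leq_card sub) _.
      case: (s); first by rewrite cL.
      by rewrite cardsD (setIidPr sLF) cL.
    * apply/pred0P=> x /=; apply/negP=> /andP[Qx] /FiF'[]; rewrite inE inE Qx //.
    * by apply: contra vF; apply: FiF.
    * by move=> x y /FiF'[F'x _]; apply: F'far.
- rewrite big_sumType /= big_pred0 // add0n big_bool /=; exact: leB'.
- rewrite big_sumType /= [X in (_ + (_ + X))%N]big_pred0 // addn0.
  rewrite cQ mulSn leq_add2l -[X in (_ <= X * _)%N]card_ord -sum_nat_const.
  by rewrite (eq_bigl predT).
Qed.

End Attachment.

(** * Splittings obtained from the doubling property *)

Section Doubling.

Variables (R : realType) (T : finType) (d : T -> T -> R) (rho : R).
Hypotheses (md : is_metric d) (cov : doubling_cover d rho).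

Let K : nat := Num.truncn (powR 2 rho).

Lemma doubling_cover_iter j x r : 0 < r -> exists C : {set T},
  (#|C| <= K ^ j)%N /\
  forall y, d x y <= r -> exists2 c, c \in C & d c y <= r / 2 ^+ j.
Proof.
move=> r_gt0; elim: j => [|j [C [leC coverC]]].
  exists [set x]; rewrite cards1; split=> // y le_y.
  by exists x; rewrite ?set11 // expr0 divr1.
have rj_gt0 : 0 < r / 2 ^+ j by rewrite divr_gt0 // exprn_gt0.
have /fin_all_exists[S coverS] : forall c, exists S : {set T}, (#|S| <= K)%N /\
    forall y, d c y <= r / 2 ^+ j -> exists2 c', c' \in S & d c' y <= r / 2 ^+ j.+1.
  move=> c; have [S [leS coverS]] := cov c rj_gt0; exists S; split.
    by rewrite truncn_ge_nat ?powR_ge0.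
  move=> y le_y; have [|c' Sc'] := coverS y; first by rewrite inE.
  rewrite inE => le_c'y; exists c' => //.
  by rewrite exprSr invfM mulrA.
exists (\bigcup_(c in C) S c); split.
  apply: leq_trans (card_bigcup_le _ _) _.
  apply: (@leq_trans (\sum_(c in C) K)); first by apply: leq_sum => c _; case: (coverS c).
  by rewrite sum_nat_const expnSr leq_mul2r leC orbT.
move=> y /coverC[c Cc] /(coverS c).2[c' Sc' le_c'].
by exists c' => //; apply/bigcupP; exists c.
Qed.

(** The colour of a point is the index of a covering centre near it; points sharing a centre are
    within twice the covering radius. *)
Lemma doubling_colouring j (A : {set T}) x r : 0 < r -> (0 < K)%N ->
  {in A, forall y, d x y <= r} ->
  exists f : T -> 'I_(K ^ j),
    {in A &, forall y z, f y = f z -> d y z <= 2 * (r / 2 ^+ j)}.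
Proof.
case: md => d_ge0 _ dC d_tri r_gt0 K_gt0 Ar.
have [C [leC coverC]] := doubling_cover_iter j x r_gt0.
have /fin_all_exists[c cP] : forall y, exists c : T, y \in A ->
    c \in C /\ d c y <= r / 2 ^+ j.
  move=> y; case Ay: (y \in A); last by exists x.
  by have [c Cc le_c] := coverC y (Ar y Ay); exists c.
have Kj_gt0 : (0 < K ^ j)%N by rewrite expn_gt0 K_gt0.
(* The default of [insubd] can only occur outside [A]. *)
exists (fun y => insubd (Ordinal Kj_gt0) (index (c y) (enum C))).
move=> y z Ay Az /(congr1 val); have [Cy ley] := cP y Ay; have [Cz lez] := cP z Az.
have ltC w : w \in C -> (index w (enum C) < K ^ j)%N.
  by move=> Cw; apply: leq_trans leC; rewrite cardE index_mem mem_enum.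
rewrite !val_insubd !ltC // => /(congr1 (nth x (enum C))).
rewrite !nth_index ?mem_enum // => eqc.
apply: le_trans (d_tri y (c y) z) _; rewrite dC mulr_natl mulr2n.
by apply: lerD => //; rewrite eqc.
Qed.

(** For a closest pair, balls of half its distance are singletons, so covering the ball that holds
    both points takes two of them. *)
Lemma doubling_constant_gt1 : (1 < #|T|)%N -> (1 < K)%N.
Proof.
case: md => d_ge0 d_eq0 dC d_tri /card_gt1P[x0 [y0 [_ _ neq0]]].
have [[x y] /= neq minxy] :=
  @arg_minP _ R _ (x0, y0) (fun p => p.1 != p.2) (fun p => d p.1 p.2) neq0.
have d_gt0 : 0 < d x y.
  by rewrite lt_neqAle d_ge0 andbT eq_sym; apply: contraNneq neq => /d_eq0 ->.
have [C [leC coverC]] := cov x d_gt0.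
have near_eq c w : d c w <= d x y / 2 -> c = w.
  move=> le_c; apply/eqP; apply: contraT => neqc.
  have := minxy (c, w) neqc => /=; lra.
have inC w : d x w <= d x y -> w \in C.
  move=> le_w; have [|c Cc] := coverC w; first by rewrite inE.
  by rewrite inE => /near_eq <-.
have xC : x \in C by apply: inC; rewrite (d_eq0 x x).2.
have yC : y \in C by apply: inC.
apply: (@leq_trans #|C|); last by rewrite truncn_ge_nat ?powR_ge0.
by apply/card_gt1P; exists x, y.
Qed.

(** Colouring the ball of radius [r / eps] around [v] gives diameter [2 * r / (eps * 2 ^+ j)]; the
    condition on [j] makes this at most [eps * r]. *)
Lemma doubling_ring_split (eps : R) (v : T) j :
  0 < eps -> (0 < K)%N -> 2 <= 2 ^+ j * eps ^+ 2 -> ring_split d v eps (K ^ j).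
Proof.
case: (md) => d_ge0 d_eq0 dC d_tri eps_gt0 K_gt0 le2 A r r_gt0 Ar.
have [|//|x Ax|f fP] := @doubling_colouring j A v (r / eps).
- exact: divr_gt0.
- by rewrite dC; apply: Ar.
exists f => x y Ax Ay eqf; apply: le_trans (fP x y Ax Ay eqf) _.
have j_gt0 : 0 < 2 ^+ j :> R by rewrite exprn_gt0.
rewrite mulrA ler_pdivrMr // mulrA ler_pdivrMr //.
have := ler_wpM2r (ltW r_gt0) le2; lra.
Qed.

(* The heavy classes are avoided by splitting a smallest ball [B] that holds
   more than half of [C]: its pieces have smaller radius, so they are light,
   and the rest of [C] is light as a whole. *)
Lemma doubling_halving_split : (0 < K)%N -> halving_split d (K ^ 2 + K ^ 2).
Proof.
case: (md) => d_ge0 d_eq0 dC d_tri K_gt0 C r C_gt1 diamC.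
have small b c : (1 < c -> c < 2 * b -> b <= 1 -> False)%N by lia.
have light_le a b c : (a <= b -> 2 * b <= c -> 2 * a <= c)%N by lia.
have light_compl a b c : (c < 2 * b -> a <= c - b -> 2 * a <= c)%N by lia.
(* Balls are coded by a centre and a point at their radius, so a smallest heavy one exists by
   finiteness. *)
pose inball (p : T * T) := [set w in C | d p.1 w <= d p.1 p.2].
pose heavy (p : T * T) := [&& p.1 \in C, p.2 \in C & (#|C| < 2 * #|inball p|)%N].
have [x0 Cx0] : exists x, x \in C by apply/card_gt0P/ltnW.
have [y0 Cy0 maxy0] := @arg_maxP _ R _ x0 (mem C) (d x0) Cx0.
have heavy0 : heavy (x0, y0).
  rewrite /heavy /= Cx0 (Cy0 : y0 \in C) (_ : inball _ = C); last first.
    apply/setP=> w; rewrite inE; case Cw: (w \in C) => //=; exact: maxy0.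
  lia.
have [[z w] /= /and3P[/= Cz Cw heavyB] minB] :=
  @arg_minP _ R _ (x0, y0) heavy (fun p => d p.1 p.2) heavy0.
set B := inball (z, w) in heavyB; set s := d z w in minB.
(* At radius 0 the ball would be one point, too few to be more than half of [C]. *)
have s_gt0 : 0 < s.
  rewrite lt_neqAle d_ge0 andbT eq_sym; apply/negP=> /eqP s0.
  have : (#|B| <= #|[set z]|)%N.
    apply/subset_leq_card/subsetP=> u; rewrite !inE /= -/s s0 => /andP[_ le_u].
    by apply/eqP/esym/d_eq0/le_anti; rewrite le_u d_ge0.
  by rewrite cards1; apply: small C_gt1 heavyB.
have s_le_r : s <= r by apply: diamC.
(* Two halvings of the radius give pieces of diameter [2 * (s / 4) = s / 2], which is below [s] and
   at most [r / 2]. *)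
have [//|//|x|g gP] := @doubling_colouring 2 B z s.
  by rewrite inE => /andP[].
have [|//|x Cx|f fP] := @doubling_colouring 2 C z r; first exact: lt_le_trans s_le_r.
  exact: diamC.
exists (fun x => if x \in B then lshift _ (g x) else rshift _ (f x)); split.
  move=> x y Cx Cy; case Bx: (x \in B); case By: (y \in B).
  - by move/lshift_inj/(gP _ _ Bx By); lra.
  - by move/eqP; rewrite eq_lrshift.
  - by move/eqP; rewrite eq_rlshift.
  - by move/rshift_inj/(fP _ _ Cx Cy); lra.
move=> i; set E := [set _ in _ | _].
have EC : E \subset C by apply/subsetP=> x; rewrite inE => /andP[].
have [E0|[u Eu]] := set_0Vmem E; first by rewrite E0 cards0.
have [/existsP[u' /andP[Eu' Bu']]|] := boolP [exists u', (u' \in E) && (u' \in B)].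
  have EB x : x \in E -> x \in B /\ g x = g u'.
    move: Eu'; rewrite !inE /= => /andP[_]; move: Bu'; rewrite !inE => -> /eqP <-.
    case/andP=> Cx; rewrite Cx /=; case: ifP => _; last by rewrite eq_rlshift.
    by move/eqP/lshift_inj.
  (* [E] lies in the ball around [u'] through its farthest point [t]; that ball has radius below
     [s], so minimality makes it light. *)
  have [t Et maxt] := @arg_maxP _ R _ u' (mem E) (d u') Eu'.
  have lt_s : d u' t < s.
    have [Bt gt] := EB t Et; have := gP u' t Bu' Bt (esym gt); lra.
  have light : ~~ heavy (u', t) by apply: contraTN lt_s => /minB; rewrite -leNgt.
  have Eball : (#|E| <= #|inball (u', t)|)%N.
    apply/subset_leq_card/subsetP=> x Ex; rewrite inE (subsetP EC) //=; exact: maxt.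
  move: light; rewrite /heavy /= !(subsetP EC) //= -leqNgt; apply: light_le Eball.
move/existsPn=> EnB.
have : (#|E| <= #|C :\: B|)%N.
  apply/subset_leq_card/subsetP=> x Ex; have := EnB x; rewrite Ex /= => nBx.
  by apply/setDP; split=> //; apply: (subsetP EC).
have sBC : B \subset C by apply/subsetP=> x; rewrite inE => /andP[].
by rewrite cardsD (setIidPr sBC); apply: light_compl heavyB.
Qed.

End Doubling.

(** * The graph of an attachment *)

Lemma walk_len_rcons (R : realType) (T : finType) (d : T -> T -> R) u p x :
  walk_len d u (rcons p x) = walk_len d u p + d (last u p) x.
Proof. by elim: p u => [|y p IHp] u /=; rewrite ?addr0 ?add0r // IHp addrA. Qed.

Section Graph.

Variables (R : realType) (T : finType) (d : T -> T -> R) (v : T).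
Variables (k : nat) (eps : R) (B h p : nat).
Variables (par : T -> {set T}) (pot : T -> R) (lvl : T -> nat).
Hypotheses (md : is_metric d) (eps_gt0 : 0 < eps).
Hypothesis att : attachment d v k eps B h [set~ v] [set v]
  (fun y => (1 + 10 * eps) * d y v) 0 p par pot lvl.

Let edge x y := (x != v) && (y \in par x).

Definition attachment_graph : rel T := fun x y => edge x y || edge y x.

Let in_neqv x : x != v -> x \in [set~ v].
Proof. by rewrite in_setC1. Qed.

Lemma attachment_graph_simple : simple_graph attachment_graph.
Proof.
split=> [x|x y]; last by rewrite /attachment_graph orbC.
rewrite /attachment_graph orbb /edge; apply/negP=> /andP[/in_neqv Fx par_x].
by have := att_lvl att Fx par_x; rewrite Fx ltnn.
Qed.

Lemma robust_survivor (Z S : {set T}) : robust v k Z -> v \notin S -> (#|S| <= k)%N ->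
  exists2 y, y \in Z & y \notin S.
Proof.
move=> /andP[_ /orP[vZ|ltZ]] vS leS; first by exists v.
have /subsetPn[y Zy nSy] : ~~ (Z \subset S); last by exists y.
by apply/negP=> /subset_leq_card; lia.
Qed.

(** Induction on the level: some parent survives, its level is smaller, and the drop in potential
    pays for the edge. General [S] yields fault tolerance, empty [S] the hop bound. *)
Lemma attachment_walk (S : {set T}) x :
    v \notin S -> (#|S| <= k)%N -> x \notin S -> x != v ->
  exists q, [/\ walk attachment_graph v x q, all (fun z => z \notin S) (v :: q),
    walk_len d v q <= pot x & (size q <= lvl x)%N].
Proof.
case: md => d_ge0 d_eq0 dC d_tri vS leS.
have [n] := ubnP (lvl x); elim: n x => // n IHn x ltn xS xv.
have Fx := in_neqv xv.
have [y par_y yS] := robust_survivor (att_robust att Fx) vS leS.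
have := att_pot att Fx par_y; have := att_lvl att Fx par_y.
have Hyx : attachment_graph y x by rewrite /attachment_graph /edge xv par_y orbT.
rewrite in_setC1; have [yv|yv] /= := eqVneq y v => lt_y le_y.
  exists [:: x]; split=> //.
  - by split=> //=; rewrite -yv Hyx.
  - by rewrite /= vS xS.
  - move: le_y; rewrite yv (d_eq0 v v).2 // mulr0 !addr0 dC /=; lra.
have [|q [[pq lq] Sq lenq szq]] := IHn y _ yS yv.
  by apply: leq_trans lt_y _.
exists (rcons q x); split.
- by split; rewrite ?last_rcons // rcons_path pq lq.
- by move: Sq; rewrite /= all_rcons xS.
- by rewrite walk_len_rcons lq dC; lra.
- by rewrite size_rcons; apply: leq_ltn_trans lt_y.
Qed.

Lemma attachment_graph_VFT : VFTssS d attachment_graph k (1 + 10 * eps) v.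
Proof.
case: (md) => d_ge0 d_eq0 dC d_tri S vS leS x xS.
have [->|xv] := eqVneq x v.
  exists [::]; rewrite /= vS; split=> //.
  by rewrite (d_eq0 v v).2 // mulr0.
have [q [wq Sq lenq _]] := attachment_walk vS leS xS xv.
exists q; split=> //; apply: le_trans lenq _.
by rewrite dC; apply: att_pot_le att _ (in_neqv xv).
Qed.

Lemma attachment_graph_hop x : exists q, [/\ walk attachment_graph v x q,
  walk_len d v q <= (1 + 10 * eps) * d v x & (size q <= h)%N].
Proof.
case: (md) => d_ge0 d_eq0 dC d_tri.
have [->|xv] := eqVneq x v.
  by exists [::]; split=> //=; rewrite (d_eq0 v v).2 // mulr0.
have [||| |q [wq _ lenq szq]] := @attachment_walk set0 x; rewrite ?inE ?cards0 //.
exists q; split=> //.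
  by apply: le_trans lenq _; rewrite dC; apply: att_pot_le att _ (in_neqv xv).
exact: leq_trans szq (att_lvl_le att (in_neqv xv)).
Qed.

Lemma attachment_graph_deg x : (p <= B)%N -> (deg attachment_graph x <= B + k.+1)%N.
Proof.
move=> lepB; pose C := [set y in [set~ v] | x \in par y].
have leC : (#|C| <= B)%N.
  have [xv|xv] := eqVneq x v; last exact: (att_degF att (in_neqv xv)).
  apply: leq_trans lepB; apply: (att_degP att); rewrite xv; exact: set11.
pose U := if x == v then set0 else par x.
have leU : (#|U| <= k.+1)%N.
  rewrite /U; have [_|xv] := eqVneq x v; first by rewrite cards0.
  by have /andP[] := att_robust att (in_neqv xv).
apply: leq_trans (leq_add leC leU); apply: leq_trans (leq_card_setU _ _).
apply/subset_leq_card/subsetP=> y; rewrite !inE /attachment_graph /edge /U.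
by case: (x == v) => /=; rewrite ?inE ?orbF // orbC.
Qed.

Lemma attachment_graph_weight :
  total_weight d attachment_graph <= (1 + eps) * k.+1%:R * \sum_x d x v.
Proof.
case: (md) => d_ge0 d_eq0 dC d_tri.
pose W := \sum_x \sum_(y | edge x y) d x y.
have leW : W <= (1 + eps) * k.+1%:R * \sum_x d x v.
  rewrite mulr_sumr; apply: ler_sum => x _.
  have [xv|xv] := eqVneq x v.
    by rewrite big_pred0 => [|y]; rewrite /edge xv ?eqxx // (d_eq0 v v).2 // mulr0.
  apply: (@le_trans _ _ (\sum_(y in par x) (1 + eps) * d x v)).
    rewrite (eq_bigl (mem (par x))) => [|y]; last by rewrite /edge xv.
    by apply: ler_sum => y; apply: att_light att _ _ (in_neqv xv).
  have /andP[lepar _] := att_robust att (in_neqv xv).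
  rewrite sumr_const -[_ *+ _]mulr_natr mulrAC ler_wpM2r // ler_wpM2l ?ler_nat //.
  by rewrite addr_ge0 ?ler01 ?ltW.
have two_gt0 : (0 : R) < 2 by lra.
apply: le_trans leW; rewrite /total_weight ler_pdivrMr //.
(* Every ordered pair of adjacent points is a parent edge in one direction or the other, so the sum
   over ordered pairs is at most [2 * W]; the halving in [total_weight] compensates. *)
pose e q := if edge q.1 q.2 then d q.1 q.2 else 0.
have eE : \sum_q e q = W.
  by rewrite /W pair_big_dep /= [RHS]big_mkcond; apply: eq_bigr => [[x y] _].
have eE' : \sum_q e (q.2, q.1) = W.
  rewrite /W (exchange_big_dep predT) //= pair_big_dep /= [RHS]big_mkcond.
  by apply: eq_bigr => [[x y] _].
rewrite mulr_natr mulr2n -{1}eE -eE' -big_split /= big_mkcond.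
apply: ler_sum => [[x y] _] /=; rewrite /e /= /attachment_graph (dC y x).
case: (edge x y); case: (edge y x) => /=; have := d_ge0 x y; lra.
Qed.

End Graph.

(** * Numerical estimates for degree and hops *)

Lemma pow2_between (R : realType) (x : R) : 1 <= x ->
  exists a : nat, [/\ (0 < a)%N, x <= 2 ^+ a & 2 ^+ a <= 2 * x].
Proof.
move=> x_ge1; have x_ge0 : 0 <= x by lra.
pose m := Num.truncn x; have m_gt0 : (0 < m)%N by rewrite truncn_gt0.
have /andP[mx xm] := truncn_itv x_ge0.
exists (trunc_log 2 m).+1; split=> //.
  apply: le_trans (ltW xm) _; rewrite -natrX ler_nat; exact: trunc_log_ltn.
rewrite exprS ler_wpM2l ?ler0n //; apply: le_trans mx.
by rewrite -natrX ler_nat; apply: trunc_logP.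
Qed.

Lemma ln2_ge_half (R : realType) : 1 / 2 <= ln (2 : R).
Proof.
have two_pos : (2 : R) \is Num.pos by rewrite posrE; lra.
have := @le_ln1Dx R (- 2^-1) _; rewrite (_ : 1 + - 2^-1 = 2^-1); last by field.
rewrite lnV // => /(_ _) le_half; have := le_half; lra.
Qed.

(** With [a >= 1] the integer logarithm, [2 * (a + 1) <= 4 * a <= 8 * a * ln 2 <= 8 * ln n]. *)
Lemma trunc_log_le_ln (R : realType) (n : nat) : (1 < n)%N ->
  (2 * (trunc_log 2 n).+1)%:R <= 8 * ln (n%:R : R).
Proof.
move=> n_gt1; set a := trunc_log 2 n.
have a_gt0 : (0 < a)%N by rewrite trunc_log_gt0.
have le_ln : a%:R * ln (2 : R) <= ln (n%:R : R).
  rewrite mulr_natl -lnXn ?ltr0n //.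
  rewrite ler_ln ?posrE ?exprn_gt0 ?ltr0n //; last lia.
  by rewrite -natrX ler_nat; apply: trunc_logP; lia.
have a_ge1 : 1 <= a%:R :> R by rewrite ler1n.
have := ler_wpM2l (ler0n R a) (ln2_ge_half R).
rewrite natrM -(natr1 a); lra.
Qed.

(* Four extra factors [K >= 2] absorb the numerical constant of the degree bound. *)
Lemma degree_bound (R : realType) (rho eps : R) (a k : nat) :
    let K := Num.truncn (powR 2 rho) in
    0 < eps -> eps <= 6^-1 -> 2 ^+ a <= 2 * eps^-1 -> (1 < K)%N -> (0 < k)%N ->
  (2 * ((K ^ (2 * a + 1)).+1 * k.+1) + k.+1)%:R <= powR eps^-1 (5%:R * rho) * k%:R.
Proof.
move=> K eps_gt0 eps_le le_a K_gt1 k_gt0; set j := (2 * a + 1)%N.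
have leK : (2 * ((K ^ j).+1 * k.+1) + k.+1 <= K ^ (j + 4) * k)%N.
  have : (2 ^ 4 <= K ^ 4)%N by rewrite leq_exp2r.
  have : (0 < K ^ j)%N by rewrite expn_gt0 (ltn_trans _ K_gt1).
  by rewrite expnD; nia.
have einv_ge6 : 6 <= eps^-1.
  by rewrite -[leLHS]invrK lef_pV2 ?posrE // invr_gt0; lra.
have K_le : K%:R <= powR 2 rho by rewrite truncn_le powR_ge0.
have rho_ge0 : 0 <= rho.
  rewrite leNgt; apply/negP=> rho_lt0.
  have := @ler_powR R 2 _ _ _ (ltW rho_lt0); rewrite powRr0 ler1n => /(_ isT).
  have : (2 : R) <= K%:R by rewrite ler_nat.
  lra.
apply: (@le_trans _ _ (K ^ (j + 4) * k)%:R); first by rewrite ler_nat.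
rewrite natrM ler_wpM2r // natrX.
have pow2_ge0 : 0 <= powR 2 rho by exact: powR_ge0.
apply: (@le_trans _ _ (powR 2 rho ^+ (j + 4))); first by rewrite lerXn2r ?nnegrE.
have einv_ge0 : 0 <= eps^-1 by lra.
(* Both sides become powers with exponent [rho >= 0], leaving the bases: [2 ^+ (2 * a + 5) <= 128 *
   eps^-1 ^+ 2 <= eps^-1 ^+ 5], as [eps^-1 ^+ 3 >= 216]. *)
rewrite -[leLHS]powR_mulrn // -powRrM mulrC (powRrM 2) (powRrM eps^-1) !powR_mulrn //.
apply: ge0_ler_powR => //; rewrite ?nnegrE ?exprn_ge0 //.
rewrite /j -addnA exprD mulnC exprM (_ : (1 + 4 = 5)%N) //.
have le2 : (2 ^+ a) ^+ 2 <= (2 * eps^-1) ^+ 2 :> R.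
  by rewrite lerXn2r ?nnegrE ?exprn_ge0 //; lra.
have le5 : 128 * eps^-1 ^+ 2 <= eps^-1 ^+ 5.
  rewrite (exprD _ 3 2) ler_wpM2r ?exprn_ge0 //.
  apply: (@le_trans _ _ (6 ^+ 3)); first lra.
  by rewrite lerXn2r ?nnegrE //; lra.
apply: le_trans le5; rewrite exprMn in le2; lra.
Qed.

(** * Assembling the spanner *)

Theorem theorem2 :
  exists c1 c2 : nat,
  forall (R : realType) (T : finType) (d : T -> T -> R) (rho : R)
         (k : nat) (eps : R) (v : T),
    is_metric d ->
    is_doubling_dim d rho ->
    (1 <= k)%N -> (k <= #|T| - 2)%N ->
    0 < eps -> eps <= 6^-1 ->
    exists H : rel T,
      [/\ simple_graph H,
          VFTssS d H k (1 + 10 * eps) v,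
          (forall x, (deg H x)%:R <= powR (eps^-1) (c1%:R * rho) * k%:R),
          (forall x, exists p : seq T,
              [/\ walk H v x p,
                  walk_len d v p <= (1 + 10 * eps) * d v x
                & (size p)%:R <= c2%:R * ln (#|T|%:R : R)]) &
          total_weight d H <= (1 + eps) * (k.+1)%:R * \sum_(x : T) d x v].
Proof.
exists 5%N, 8%N => R T d rho k eps v md [cov _] k_gt0 lek eps_gt0 eps_le.
have T_gt1 : (1 < #|T|)%N by lia.
have K_gt1 := doubling_constant_gt1 md cov T_gt1.
have K_gt0 := ltnW K_gt1.
have einv_ge1 : 1 <= eps^-1 by rewrite -[leLHS]invr1 lef_pV2 ?posrE //; lra.
have [a [a_gt0 le_a a_le]] := pow2_between einv_ge1.
set K := Num.truncn (powR 2 rho) in K_gt1 K_gt0.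
set j := (2 * a + 1)%N; set M := (K ^ j)%N.
(* Since [2 ^+ a * eps >= 1], the exponent [2 * a] gives 1 and the extra [+ 1] in [j] gives the
   factor 2. *)
have le2 : 2 <= 2 ^+ j * eps ^+ 2 :> R.
  have ge1 : 1 <= (2 ^+ a * eps) ^+ 2.
    apply: exprn_ege1; rewrite -[leLHS](mulVf (lt0r_neq0 eps_gt0)).
    by rewrite ler_wpM2r // ltW.
  rewrite exprMn -exprM in ge1.
  rewrite /j exprD mulnC expr1; lra.
pose B := (2 * (M.+1 * k.+1))%N; pose m := (trunc_log 2 #|T|).+1.
have leB : ((K ^ 2 + K ^ 2) * k.+1 <= B)%N.
  have leM : (K ^ 2 <= M)%N by rewrite /M leq_pexp2l //; lia.
  by rewrite /B mulnA leq_mul2r mul2n -addnn leq_add ?orbT // ltnW.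
(* The recursion starts from the single portal [v], at level 0 and with potential 0. *)
have [par [pot [lvl att]]] : attachable d v k eps B (2 * m) [set~ v] [set v]
    (fun y => (1 + 10 * eps) * d y v) 0 (M.+1 * k.+1).
  case: (md) => d_ge0 d_eq0 _ _.
  apply: (attachable_rings (N := (K ^ 2 + K ^ 2)%N) (m := m)) => //.
  - exact: doubling_halving_split.
  - exact: doubling_ring_split.
  - apply: (@leq_ltn_trans #|T|); first exact: max_card.
    exact: trunc_log_ltn.
  - by rewrite /robust cards1 set11.
  - by rewrite disjoints1 !inE eqxx.
  - by rewrite !inE eqxx.
  - move=> x y _ /set1P->; rewrite (d_eq0 v v).2 //.
    by rewrite mulr_ge0 // ltW.
exists (attachment_graph v par); split.
- exact: attachment_graph_simple att.
- exact: attachment_graph_VFT md eps_gt0 att.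
- move=> x; apply: le_trans (degree_bound eps_gt0 eps_le a_le K_gt1 k_gt0).
  rewrite ler_nat; apply: (attachment_graph_deg att); by rewrite leq_pmull.
- move=> x; have [q [wq lenq szq]] := attachment_graph_hop md eps_gt0 att x.
  exists q; split=> //; apply: le_trans (trunc_log_le_ln R T_gt1).
  by rewrite ler_nat.
- exact: attachment_graph_weight md eps_gt0 att.
Qed.
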